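(* Let $p^*$ be a halfspace-symmetric probability distribution on $\mathbb{R}^d$ with center $\mu^*$ and decay function $h(t)=\sup_{v\in\mathbb{R}^d,\ \|v\|_*\le 1} p^*(v^\top(X-\mu^* )>t)$, $t\ge 0$. Let $0\le\epsilon<1/2$. Then for any probability distribution $p$ on $\mathbb{R}^d$ with $\mathsf{TV}(p^*,p)\le\epsilon$, the projection estimator $$\hat\mu(p)=\mathbb{E}_q[X],\qquad \text{where } q=\operatorname{argmin}_{q\in\mathcal{G}(h)}\widetilde{\mathsf{TV}}(q,p),$$ satisfies $$\|\hat\mu(p)-\mu^*\|\le 2h^{-1}\left(1/2-\epsilon\right),$$ where $h^{-1}(y)=\inf\{x : h(x)<y\}$ is the generalized inverse of $h$.
   Context: $\|\cdot\|$ is a norm on $\mathbb{R}^d$ and $\|\cdot\|_*$ is its dual norm. The function $h$ is defined on $[0,\infty)$ and the infimum in $h^{-1}(y)$ is over $x\ge 0$. Halfspace-symmetric: a distribution $p$ on $\mathbb{R}^d$ is halfspace-symmetric with center $\mu\in\mathbb{R}^d$ if, for $X\sim p$ and every $v\in\mathbb{R}^d$, $v^\top(X-\mu)$ and $-v^\top(X-\mu)$ are equal in distribution. The paper's convention is that the center $\mu$ is the mean of $p$; thus $\mathbb{E}_q[X]$ for halfspace-symmetric $q$ is the center of $q$. Distances: $\mathsf{TV}(p,q)=\sup_A\,(p(A)-q(A))$ over events $A$, and the halfspace metric is $\widetilde{\mathsf{TV}}(p,q)=\sup_{v\in\mathbb{R}^d,\,t\in\mathbb{R}}|p(v^\top X\ge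 t)-q(v^\top X\ge t)|$. The class $\mathcal{G}(h)$ is the set of all distributions $p$ on $\mathbb{R}^d$ that are halfspace-symmetric around some $\mu$ (depending on $p$) and satisfy $\sup_{v\in\mathbb{R}^d,\,\|v\|_*\le 1}p(v^\top(X-\mu)>t)\le h(t)$ for all $t\ge 0$. In the definition of $\hat\mu(p)$, $q$ denotes a minimizer of $\widetilde{\mathsf{TV}}(\cdot,p)$ over $\mathcal{G}(h)$. *)

(* Defs.v *)
From HB Require Import structures.
From mathcomp Require Import all_boot all_order all_algebra.
From mathcomp Require Import lra.
From mathcomp Require Import all_classical all_reals all_analysis.
From mathcomp Require Import measurable_realfun.
Set Implicit Arguments.
Unset Strict Implicit.
Unset Printing Implicit Defensive.
Import Order.TTheory GRing.Theory Num.Theory.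
Import numFieldTopology.Exports numFieldNormedType.Exports.
Local Open Scope classical_set_scope.
Local Open Scope ring_scope.
Local Open Scope ereal_scope.

(* R^d with its Borel sigma-algebra. *)
Notation borelRd R d := (g_sigma_algebraType (@open 'cV[R%type]_d)).

Definition dot (R : realType) (d : nat) (v x : 'cV[R]_d) : R :=
  (v^T *m x)%R ord0 ord0.

Record is_norm (R : realType) (d : nat) (N : 'cV[R]_d -> R) : Prop := IsNorm {
  is_norm_triangle : forall x y, (N (x + y) <= N x + N y)%R ;
  is_norm_homogeneous : forall (a : R) x, N (a *: x)%R = (`|a| * N x)%R ;
  is_norm_definite : forall x, N x = 0%R -> x = 0%R }.

(* Suprema and infima are taken in \bar R, so that no value depends on the
   convention for sets that are empty or unbounded in R. *)
Definition dual_norm (R : realType) (d : nat) (N : 'cV[R]_d -> R)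
    (v : 'cV[R]_d) : \bar R :=
  ereal_sup [set (dot v x)%:E | x in [set x : 'cV[R]_d | (N x <= 1)%R]].

Definition halfspace_symmetric (R : realType) (d : nat)
    (p : probability (borelRd R d) R) (mu : 'cV[R]_d) : Prop :=
  forall (v : 'cV[R]_d) (A : set R), measurable A ->
    pushforward p (fun x : borelRd R d => dot v (x - mu)%R) A =
    pushforward p (fun x : borelRd R d => (- dot v (x - mu))%R) A.

Definition TV (disp : measure_display) (T : measurableType disp)
    (R : realType) (p q : probability T R) : \bar R :=
  ereal_sup [set p A - q A | A in [set A : set T | measurable A]].

Definition halfspace_TV (R : realType) (d : nat)
    (p q : probability (borelRd R d) R) : \bar R :=
  ereal_sup [set `| p [set x : borelRd R d | (vt.2 <= dot vt.1 x)%R]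
                    - q [set x : borelRd R d | (vt.2 <= dot vt.1 x)%R] |
            | vt in [set: 'cV[R]_d * R]].

Definition decay (R : realType) (d : nat) (N : 'cV[R]_d -> R)
    (p : probability (borelRd R d) R) (mu : 'cV[R]_d) (t : R) : \bar R :=
  ereal_sup [set p [set x : borelRd R d | (t < dot v (x - mu))%R]
            | v in [set v : 'cV[R]_d | dual_norm N v <= 1]].

Definition gen_inverse (R : realType) (h : R -> \bar R) (y : \bar R) : \bar R :=
  ereal_inf [set x%:E | x in [set x : R | (0 <= x)%R /\ h x < y]].

Definition class_G (R : realType) (d : nat) (N : 'cV[R]_d -> R)
    (h : R -> \bar R) : set (probability (borelRd R d) R) :=
  [set p | exists mu : 'cV[R]_d, halfspace_symmetric p mu /\
             forall t : R, (0 <= t)%R -> decay N p mu t <= h t].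

Definition is_projection (R : realType) (d : nat) (N : 'cV[R]_d -> R)
    (h : R -> \bar R) (p q : probability (borelRd R d) R) : Prop :=
  class_G N h q /\
  forall q' : probability (borelRd R d) R,
    class_G N h q' -> halfspace_TV q p <= halfspace_TV q' p.

(* The mean of a halfspace-symmetric law is its center, which is unique
   ([halfspace_symmetric_center_unique] below). For integrable laws it is the
   expectation ([halfspace_symmetric_mean]), and it keeps a meaning for laws with
   no first moment, which [class_G N h] may contain. A projection need not be
   unique, whence a relation rather than a function of [p]. *)
Definition projection_estimate (R : realType) (d : nat) (N : 'cV[R]_d -> R)
    (h : R -> \bar R) (p : probability (borelRd R d) R)
    (muhat : 'cV[R]_d) : Prop :=
  exists q : probability (borelRd R d) R,
    is_projection N h p q /\ halfspace_symmetric q muhat.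

Lemma dot_delta (R : realType) (d : nat) (i : 'I_d) (x : 'cV[R]_d) :
  dot (delta_mx i ord0) x = x i ord0.
Proof. by rewrite /dot trmx_delta -rowE mxE. Qed.

Lemma measurable_coord (R : realType) (d : nat) (i : 'I_d) :
  measurable_fun setT (fun x : borelRd R d => (x : 'cV[R]_d) i ord0).
Proof.
apply: (measurability _ (RGenOpens.measurableE R)).
move=> _ [_ [a [b ->] <-]].
rewrite setTI; apply: sub_sigma_algebra.
apply: open_comp; last exact: interval_open.
by move=> x _; exact: coord_continuous.
Qed.

Lemma halfspace_symmetric_center_unique (R : realType) (d : nat)
    (p : probability (borelRd R d) R) (mu mu' : 'cV[R]_d) :
  halfspace_symmetric p mu -> halfspace_symmetric p mu' -> mu = mu'.
Proof.
have tail m i s : halfspace_symmetric p m ->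
    p [set x : borelRd R d | (s < (x : 'cV[R]_d) i ord0)%R] =
    p [set x : borelRd R d | ((x : 'cV[R]_d) i ord0 < m i ord0 *+ 2 - s)%R].
  move=> /(_ (delta_mx i ord0) `](s - m i ord0)%R, +oo[%classic (measurable_itv _)).
  rewrite /pushforward => eqp.
  transitivity (p ((fun x : borelRd R d =>
      dot (delta_mx i ord0) (x - m)%R) @^-1` `](s - m i ord0)%R, +oo[%classic)).
    congr (p _); apply/seteqP; split => x /=;
      rewrite in_itv/= andbT dot_delta !mxE; lra.
  rewrite eqp; congr (p _); apply/seteqP; split => x /=;
    rewrite in_itv/= andbT dot_delta !mxE; lra.
suff main (m m' : 'cV[R]_d) i : halfspace_symmetric p m ->
    halfspace_symmetric p m' -> ~ (m i ord0 < m' i ord0)%R.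
  move=> h h'; apply/colP => i.
  by case: (ltgtP (mu i ord0) (mu' i ord0)) => // /main; case.
move=> {mu mu'}; move: m m' => mu mu' h h' lt_mu.
pose e := ((mu' i ord0 - mu i ord0) *+ 2)%R.
have e0 : (0 < e)%R by rewrite /e; lra.
pose F (s : R) := [set x : borelRd R d | (s < (x : 'cV[R]_d) i ord0)%R].
have mF s : measurable (F s).
  have := measurable_coord i measurableT (measurable_itv `]s, +oo[).
  rewrite setTI; congr measurable; apply/seteqP.
  by split => x /=; rewrite in_itv/= andbT.
have shift s : p (F s) = p (F (s + e)%R).
  rewrite /F (tail mu) // (tail mu') //; congr (p _).
  by apply/seteqP; split => x /=; rewrite /e; lra.
have Fconst (n : nat) : p (F (n%:R * e)%R) = p (F 0%R).
  elim: n => [|n IH]; first by rewrite mul0r.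
  by rewrite -IH [RHS]shift; congr (p (F _)); rewrite -natr1; lra.
have FconstN (n : nat) : p (F (- (n%:R * e))%R) = p (F 0%R).
  elim: n => [|n IH]; first by rewrite mul0r oppr0.
  by rewrite -IH [LHS]shift; congr (p (F _)); rewrite -natr1; lra.
have arch (y : R) : exists n : nat, (y < n%:R * e)%R.
  exists (Num.truncn `|y / e|%R).+1; rewrite -ltr_pdivrMr//.
  by apply: (le_lt_trans (ler_norm _)); exact: truncnS_gt.
have cap0 : \bigcap_n F (n%:R * e)%R = set0.
  rewrite -subset0 => x Fx; have [n] := arch ((x : 'cV[R]_d) i ord0).
  by have := Fx n I; rewrite /F/=; lra.
have cupT : \bigcup_n F (- (n%:R * e))%R = setT.
  rewrite -subTset => x _; have [n xn] := arch (- (x : 'cV[R]_d) i ord0)%R.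
  by exists n => //; rewrite /F/=; lra.
have le_mul (n m : nat) : (n <= m)%N -> (n%:R * e <= m%:R * e)%R.
  by move=> nm; rewrite ler_wpM2r ?ler_nat// ltW.
have cvg0 : p \o (fun n : nat => F (n%:R * e)%R) @ \oo --> p set0.
  rewrite -cap0; apply: nonincreasing_cvg_mu => //.
  - by rewrite (le_lt_trans (probability_le1 _ (mF _)))// ltry.
  - by rewrite cap0.
  - move=> n m nm; apply/subsetPset => x; rewrite /F/=.
    by have := le_mul _ _ nm; lra.
have cvg1 : p \o (fun n : nat => F (- (n%:R * e))%R) @ \oo --> p setT.
  rewrite -cupT; apply: nondecreasing_cvg_mu => //.
  - by rewrite cupT.
  - move=> n m nm; apply/subsetPset => x; rewrite /F/=.
    by have := le_mul _ _ nm; lra.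
have : p (F 0%R) = p set0.
  apply: (@cvg_unique _ (@ereal_hausdorff R)) cvg0.
  have -> : p \o (fun n : nat => F (n%:R * e)%R) = cst (p (F 0%R)).
    by apply/funext => n; exact: Fconst.
  exact: cvg_cst.
have : p (F 0%R) = p setT.
  apply: (@cvg_unique _ (@ereal_hausdorff R)) cvg1.
  have -> : p \o (fun n : nat => F (- (n%:R * e))%R) = cst (p (F 0%R)).
    by apply/funext => n; exact: FconstN.
  exact: cvg_cst.
move=> ->; rewrite measure0 probability_setT => /eqP.
by rewrite onee_eq0.
Qed.

Lemma halfspace_symmetric_mean (R : realType) (d : nat)
    (p : probability (borelRd R d) R) (mu : 'cV[R]_d) (i : 'I_d) :
  halfspace_symmetric p mu ->
  p.-integrable setT (fun x : borelRd R d => ((x : 'cV[R]_d) i ord0)%:E) ->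
  \int[p]_x ((x : 'cV[R]_d) i ord0)%:E = (mu i ord0)%:E.
Proof.
move=> /(_ (delta_mx i ord0)) sym intx.
pose f (x : borelRd R d) : R := ((x : 'cV[R]_d) i ord0 - mu i ord0)%R.
have fE : (fun x : borelRd R d => dot (delta_mx i ord0) (x - mu)%R) = f.
  by apply/funext => x; rewrite dot_delta !mxE.
have fNE : (fun x : borelRd R d => - dot (delta_mx i ord0) (x - mu))%R
         = (fun x => - f x)%R.
  by apply/funext => x; rewrite dot_delta !mxE.
rewrite fE fNE in sym.
have intc := @finite_measure_integrable_cst _ _ _ p setT (mu i ord0) measurableT.
have intf : p.-integrable setT (EFin \o f).
  by have := integrableB measurableT intx intc.
have mf : measurable_fun setT f by apply/measurable_EFinP; case/integrableP: intf.
have mfN : measurable_fun setT (fun x => - f x)%R by exact: measurableT_comp.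
have intfN : p.-integrable setT (EFin \o (fun x => - f x)%R).
  by have := integrableN intf.
have mE : measurable_fun [set: R] (@EFin R) by [].
have eqf : \int[p]_x (f x)%:E = - \int[p]_x (f x)%:E.
  have := @integral_pushforward _ _ _ _ R _ mf p setT _ mE intf measurableT.
  rewrite preimage_setT => step.
  transitivity (\int[pushforward p f]_y y%:E); first by rewrite step.
  rewrite (eq_measure_integral (pushforward p (fun x => - f x)%R)); last first.
    by move=> A mA _; exact: sym.
  rewrite (@integral_pushforward _ _ _ _ R _ mfN p setT _ mE intfN measurableT).
  rewrite preimage_setT; transitivity (\int[p]_x (- (f x)%:E)); first by [].
  by rewrite integralN//; exact: (integrable_add_def measurableT intf).
have f0 : \int[p]_x (f x)%:E = 0.
  move: eqf; have := integrable_fin_num measurableT intf.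
  case: (\int[p]_x _) => // r _ [] r0; congr EFin; lra.
have : \int[p]_x (f x)%:E =
    \int[p]_x ((x : 'cV[R]_d) i ord0)%:E - \int[p]_x (mu i ord0)%:E.
  exact: (integralB_EFin measurableT intx intc).
have -> : \int[p]_x (mu i ord0)%:E = (mu i ord0)%:E.
  by rewrite -[RHS]mule1 -(probability_setT p); exact: integral_cst.
rewrite f0.
move: (integrable_fin_num measurableT intx).
case: (\int[p]_x _) => // r _ [] r0; congr EFin; lra.
Qed.

(* Main.v *)
Require Import Defs.
From mathcomp Require Import all_boot all_order all_algebra.
From mathcomp Require Import lra.
From mathcomp Require Import all_classical all_reals all_analysis.
From mathcomp Require Import measurable_realfun.
Import Order.TTheory GRing.Theory Num.Theory.
Import numFieldTopology.Exports numFieldNormedType.Exports.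
Local Open Scope classical_set_scope.
Local Open Scope ring_scope.
Local Open Scope ereal_scope.

(** Write [h] for the decay function of [pstar], let [q] be a projection of [p],
    with center [muhat], and let [t >= 0] satisfy [h t < 1/2 - eps].

    [pstar] itself belongs to the class over which [q] is optimal, so [q] is at
    least as close to [p] in the halfspace metric as [pstar] is, hence within
    [eps]; halfspaces being events, [pstar] is within [eps] of [p] as well. Every
    halfspace thus has masses under [q] and [pstar] that differ by at most
    [2 * eps].

    Suppose that [N (muhat - mustar) > 2 * t]. Hahn-Banach provides [v] of dual
    norm at most 1 with [dot v (muhat - mustar) = N (muhat - mustar)]
    ([norming_functional]). The hyperplane orthogonal to [v] midway between the two
    centers lies at [v]-distance more than [t] from both of them. Of the two
    halfspaces that it bounds, the one containing [muhat] therefore has mass less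
    than [1/2 - eps] under [pstar], and its complement has mass less than
    [1/2 - eps] under [q] ([halfspace_separation]). The two masses of that
    halfspace then differ by more than [2 * eps], a contradiction. Taking the
    infimum over [t] gives the bound.

    The bound at [q] is around whichever center witnesses membership in the
    class; uniqueness of the center identifies it with [muhat]. *)

Lemma dot_sum {R : realType} {d : nat} (v x : 'cV[R]_d) :
  dot v x = (\sum_(i < d) v i ord0 * x i ord0)%R.
Proof. by rewrite /dot mxE; apply: eq_bigr => i _; rewrite mxE. Qed.

Lemma dotDr {R : realType} {d : nat} (v x y : 'cV[R]_d) :
  dot v (x + y)%R = (dot v x + dot v y)%R.
Proof. by rewrite /dot mulmxDr mxE. Qed.

Lemma dotDl {R : realType} {d : nat} (v w x : 'cV[R]_d) :
  dot (v + w)%R x = (dot v x + dot w x)%R.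
Proof. by rewrite /dot linearD/= mulmxDl mxE. Qed.

Lemma dotZr {R : realType} {d : nat} (a : R) (v x : 'cV[R]_d) :
  dot v (a *: x)%R = (a * dot v x)%R.
Proof. by rewrite /dot -scalemxAr mxE. Qed.

Lemma dotZl {R : realType} {d : nat} (a : R) (v x : 'cV[R]_d) :
  dot (a *: v)%R x = (a * dot v x)%R.
Proof. by rewrite /dot linearZ/= -scalemxAl mxE. Qed.

Lemma dot0r {R : realType} {d : nat} (v : 'cV[R]_d) : dot v 0%R = 0%R.
Proof. by rewrite /dot mulmx0 mxE. Qed.

Lemma dot0l {R : realType} {d : nat} (x : 'cV[R]_d) : dot 0%R x = 0%R.
Proof. by rewrite /dot trmx0 mul0mx mxE. Qed.

Lemma dotNr {R : realType} {d : nat} (v x : 'cV[R]_d) :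
  dot v (- x)%R = (- dot v x)%R.
Proof. by rewrite -scaleN1r dotZr mulN1r. Qed.

Lemma dotNl {R : realType} {d : nat} (v x : 'cV[R]_d) :
  dot (- v)%R x = (- dot v x)%R.
Proof. by rewrite -scaleN1r dotZl mulN1r. Qed.

Lemma dotBr {R : realType} {d : nat} (v x y : 'cV[R]_d) :
  dot v (x - y)%R = (dot v x - dot v y)%R.
Proof. by rewrite dotDr dotNr. Qed.

(** The one-dimensional step of Hahn-Banach. The partial functional is given by its
    graph [G], so that neither its domain nor a formula for it has to be named.
    By homogeneity, domination along [e] and [- e] suffices: the value at [e] has
    to lie above all [r - N (x - e)] and below all [N (y + e) - s]. Subadditivity
    puts every lower bound below every upper bound, so the supremum of the lower
    bounds is such a value. *)
Lemma dominated_extension {R : realType} {V : lmodType R} {N : V -> R}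
    (NZ : forall (a : R) x, N (a *: x)%R = (`|a| * N x)%R)
    (ND : forall x y, (N (x + y) <= N x + N y)%R)
    (G : V -> R -> Prop)
    (G0 : G 0%R 0%R)
    (GD : forall x y r s, G x r -> G y s -> G (x + y)%R (r + s)%R)
    (GZ : forall a x r, G x r -> G (a *: x)%R (a * r)%R)
    (GN : forall x r, G x r -> (r <= N x)%R) (e : V) :
  exists a : R, forall x r s, G x r -> (r + s * a <= N (x + s *: e))%R.
Proof.
pose A := [set b : R | exists x r, G x r /\ b = (r - N (x - e))%R].
have cross x r y s : G x r -> G y s -> (r - N (x - e) <= N (y + e) - s)%R.
  move=> Gx Gy; have := GN _ _ (GD _ _ _ _ Gx Gy).
  have := ND (x - e)%R (y + e)%R.
  by rewrite addrACA (addrC (- e)%R) subrr addr0; lra.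
have ubA y s : G y s -> ubound A (N (y + e) - s)%R.
  by move=> Gy _ [x [r [Gx ->]]]; exact: cross.
have N_homothety t x u : (0 < t)%R -> N (x + t *: u)%R = (t * N (t^-1 *: x + u))%R.
  move=> t0; rewrite -[X in (X * _)%R](gtr0_norm t0) -NZ scalerDr scalerA.
  by rewrite divff ?gt_eqF// scale1r.
have A0 : A !=set0 by exists (0 - N (0 - e))%R, 0%R, 0%R.
exists (sup A) => x r s Gx.
have [s0|s0|->] := ltgtP s 0%R; last by rewrite mul0r scale0r !addr0; exact: GN.
- have t0 : (0 < - s)%R by rewrite oppr_gt0.
  have : ((- s)^-1 * r - N ((- s)^-1 *: x - e) <= sup A)%R.
    apply: ub_le_sup; first by exists (N (0 + e) - 0)%R; exact: ubA.
    by exists ((- s)^-1 *: x)%R, ((- s)^-1 * r)%R; split => //; exact: GZ.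
  rewrite -(ler_pM2l t0) mulrBr mulrA divff ?gt_eqF// mul1r.
  have := N_homothety (- s)%R x (- e)%R t0.
  by rewrite scalerN scaleNr opprK => ->; lra.
- have : (sup A <= N (s^-1 *: x + e) - s^-1 * r)%R.
    by apply: ge_sup A0 _; apply: ubA; exact: GZ.
  rewrite -(ler_pM2l s0) mulrBr mulrA divff ?gt_eqF// mul1r.
  by rewrite (N_homothety _ _ _ s0); lra.
Qed.

(** Hahn-Banach for the functional sending [c *: z] to [c * N z], which is
    extended from the line of [z] by one basis vector at a time. *)
Lemma norming_functional {R : realType} {d : nat} {N : 'cV[R]_d -> R}
    (hN : is_norm N) (z : 'cV[R]_d) :
  exists v : 'cV[R]_d, (forall x, (dot v x <= N x)%R) /\ dot v z = N z.
Proof.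
have NZ := is_norm_homogeneous hN.
have ND := is_norm_triangle hN.
have N0 : N 0%R = 0%R by rewrite -(scale0r (0%R : 'cV[R]_d)) NZ normr0 mul0r.
have N_ge0 x : (0 <= N x)%R.
  have := ND x (- x)%R.
  by rewrite subrr N0 -scaleN1r NZ normrN1 mul1r; lra.
pose low k (x : 'cV[R]_d) := forall i : 'I_d, (k <= i)%N -> x i ord0 = 0%R.
(* Keeping the coefficient [c] of [z] apart from [x] lets the functional on the
   span of [z] and the first [k] basis vectors be recorded by [v] alone. Once [v]
   is complete, [c = 1] and [x = - z] force [dot v z = N z]. *)
suff [v vN] : exists v, forall c x, low d x ->
    (c * N z + dot v x <= N (c *: z + x))%R.
  have vx x : (dot v x <= N x)%R.
    have := vN 0%R x; rewrite mul0r scale0r !add0r; apply.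
    by move=> i; rewrite leqNgt ltn_ord.
  exists v; split => //; apply/eqP; rewrite eq_le vx/=.
  have := vN 1%R (- z)%R.
  rewrite scale1r subrr N0 dotNr mul1r subr_le0; apply.
  by move=> i; rewrite leqNgt ltn_ord.
suff main k : (k <= d)%N -> exists v, forall c x, low k x ->
    (c * N z + dot v x <= N (c *: z + x))%R by exact: main.
elim: k => [_|k IH kd].
  exists 0%R => c x x0.
  have -> : x = 0%R by apply/colP => i; rewrite mxE x0.
  rewrite dot0l !addr0 NZ.
  by rewrite ler_wpM2r// ler_norm.
have [v vN] := IH (ltnW kd); pose j := Ordinal kd.
pose G y r := exists c x,
  [/\ low k x, y = (c *: z + x)%R & r = (c * N z + dot v x)%R].
have [||||a aN] := dominated_extension NZ ND G _ _ _ _ (delta_mx j ord0).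
- exists 0%R, 0%R; split; first by move=> i _; rewrite mxE.
  + by rewrite scale0r addr0.
  + by rewrite mul0r dot0r addr0.
- move=> _ _ _ _ [c [x [x0 -> ->]]] [c' [x' [x0' -> ->]]].
  exists (c + c')%R, (x + x')%R; split.
  + by move=> i ki; rewrite mxE x0// x0'// addr0.
  + by rewrite scalerDl addrACA.
  + by rewrite mulrDl dotDr addrACA.
- move=> b _ _ [c [x [x0 -> ->]]]; exists (b * c)%R, (b *: x)%R; split.
  + by move=> i ki; rewrite mxE x0// mulr0.
  + by rewrite scalerDr scalerA.
  + by rewrite dotZr mulrDr mulrA.
- by move=> _ _ [c [x [x0 -> ->]]]; exact: vN.
(* Coordinate [j] of [v] is replaced by the value [a] found for the basis
   vector. *)
exists (v + (a - v j ord0) *: delta_mx j ord0)%R => c x x0.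
pose y : 'cV[R]_d := (x - x j ord0 *: delta_mx j ord0)%R.
have y0 : low k y.
  move=> i; rewrite leq_eqVlt => /predU1P[ki|ki].
    have -> : i = j by exact: val_inj.
    by rewrite !mxE !eqxx mulr1 subrr.
  by rewrite !mxE (x0 _ ki) -val_eqE/= (gtn_eqF ki) mulr0 subrr.
have := aN (c *: z + y)%R (c * N z + dot v y)%R (x j ord0).
have -> : (c *: z + y + x j ord0 *: delta_mx j ord0 = c *: z + x)%R.
  by rewrite -addrA subrK.
have -> : (c * N z + dot v y + x j ord0 * a =
  c * N z + dot (v + (a - v j ord0) *: delta_mx j ord0) x)%R.
  have dotvj : dot v (delta_mx j ord0) = v j ord0.
    rewrite dot_sum (bigD1 j)//= big1 ?mxE ?eqxx ?mulr1 ?addr0// => i ij.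
    by rewrite mxE (negbTE ij) mulr0.
  by rewrite dotDl dotZl dot_delta dotBr dotZr dotvj; lra.
by apply; exists c, y.
Qed.

(** [TV] is a supremum of signed differences; passing to the complement of the
    event reverses the sign. *)
Lemma abse_sub_le_TV {disp : measure_display} {T : measurableType disp}
    {R : realType} (p q : probability T R) (A : set T) :
  measurable A -> `|p A - q A| <= TV p q.
Proof.
move=> mA.
have le_TV B : measurable B -> p B - q B <= TV p q.
  by move=> mB; apply: ereal_sup_ubound; exists B.
have := le_TV _ (measurableC mA); rewrite !probability_setC//.
have := le_TV _ mA.
have [a ->] : exists a, p A = a%:E.
  by exists (fine (p A)); rewrite fineK// fin_num_measure.
have [b ->] : exists b, q A = b%:E.
  by exists (fine (q A)); rewrite fineK// fin_num_measure.
case: (TV p q) => [t| |]//=; last by rewrite !leey.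
by rewrite !lee_fin ler_norml; lra.
Qed.

Lemma measurable_dot {R : realType} {d : nat} (v : 'cV[R]_d) :
  measurable_fun setT (fun x : borelRd R d => dot v x).
Proof.
under eq_fun do rewrite dot_sum.
apply: measurable_sum => i.
by apply: measurable_funM => //; exact: measurable_coord.
Qed.

Lemma measurable_halfspace {R : realType} {d : nat} (v : 'cV[R]_d) (s : R) :
  measurable [set x : borelRd R d | (s <= dot v x)%R].
Proof.
have := measurable_dot v measurableT _ (measurable_itv `[s, +oo[).
rewrite setTI; congr measurable; apply/seteqP.
by split => x /=; rewrite in_itv/= andbT.
Qed.

Lemma measurable_open_halfspace {R : realType} {d : nat} (v m : 'cV[R]_d) (s : R) :
  measurable [set x : borelRd R d | (s < dot v (x - m))%R].
Proof.
have := measurable_dot v measurableT _ (measurable_itv `](s + dot v m)%R, +oo[).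
rewrite setTI; congr measurable; apply/seteqP.
by split => x /=; rewrite in_itv/= andbT dotBr ltrBrDr.
Qed.

Lemma halfspace_TV_le_TV {R : realType} {d : nat}
    (p q : probability (borelRd R d) R) : halfspace_TV p q <= TV p q.
Proof.
apply: ge_ereal_sup => _ [[v s] _ <-]; apply: abse_sub_le_TV.
exact: measurable_halfspace.
Qed.

(** Domination by [N] is the form in which [norming_functional] expresses that the
    dual norm of [v] is at most 1. *)
Lemma le_decay {R : realType} {d : nat} {N : 'cV[R]_d -> R}
    (p : probability (borelRd R d) R) (mu : 'cV[R]_d) {v : 'cV[R]_d} (t : R) :
  (forall x, (dot v x <= N x)%R) ->
  p [set x : borelRd R d | (t < dot v (x - mu))%R] <= decay N p mu t.
Proof.
move=> vN; apply: ereal_sup_ubound; exists v => //.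
apply: ge_ereal_sup => _ [x Nx <-]; rewrite lee_fin.
exact: le_trans (vN x) Nx.
Qed.

(** The boundary of the halfspace passes through the midpoint of the centers in a
    norming direction [v], hence at [v]-distance more than [t] from each of them.
    The decay of [p] is used in direction [v] and that of [q] in direction [- v]. *)
Lemma halfspace_separation {R : realType} {d : nat} {N : 'cV[R]_d -> R}
    (hN : is_norm N) {p q : probability (borelRd R d) R} {mu nu : 'cV[R]_d}
    {t a : R} :
  (t *+ 2 < N (nu - mu))%R ->
  decay N p mu t < a%:E -> decay N q nu t < a%:E ->
  exists v s, p [set x : borelRd R d | (s <= dot v x)%R] < a%:E /\
    1 - a%:E < q [set x : borelRd R d | (s <= dot v x)%R].
Proof.
move=> tN pa qa; have [v [vN vz]] := norming_functional hN (nu - mu)%R.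
have NvN x : (dot (- v) x <= N x)%R.
  rewrite dotNl -dotNr; apply: le_trans (vN _) _.
  by rewrite -scaleN1r (is_norm_homogeneous hN) normrN1 mul1r.
rewrite dotBr in vz.
exists v, ((dot v mu + dot v nu) / 2)%R; set H := [set x | _].
have mH : measurable H by exact: measurable_halfspace.
split.
- apply: le_lt_trans pa; apply: le_trans (le_decay p mu t vN).
  apply: le_measure; rewrite ?inE//; first exact: measurable_open_halfspace.
  by move=> x; rewrite /H/= dotBr; lra.
- have : q (~` H) < a%:E.
    apply: le_lt_trans qa; apply: le_trans (le_decay q nu t NvN).
    apply: le_measure; rewrite ?inE//; first exact: measurableC.
      exact: measurable_open_halfspace.
    by move=> x /negP; rewrite -ltNge /= dotNl dotBr; lra.
  rewrite probability_setC//.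
  have -> : q H = (fine (q H))%:E by rewrite fineK// fin_num_measure.
  by rewrite -!EFinB !lte_fin; lra.
Qed.

Theorem theorem4 (R : realType) (d : nat) (N : 'cV[R]_d -> R) (hN : is_norm N)
    (pstar : probability (borelRd R d) R) (mustar : 'cV[R]_d)
    (hsym : halfspace_symmetric pstar mustar)
    (eps : R) (heps0 : (0 <= eps)%R) (heps : (eps < 2^-1)%R)
    (p : probability (borelRd R d) R) (hTV : TV pstar p <= eps%:E)
    (muhat : 'cV[R]_d)
    (hmuhat : projection_estimate N (decay N pstar mustar) p muhat) :
  (N (muhat - mustar)%R)%:E <=
    2%:E * gen_inverse (decay N pstar mustar) (2^-1 - eps)%:E.
Proof.
have [q [[[nu [qsym qdecay]] qmin] qsym']] := hmuhat.
have nuE : nu = muhat by exact: halfspace_symmetric_center_unique qsym qsym'.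
rewrite {nu qsym}nuE in qdecay.
rewrite muleC -lee_pdivrMr//; apply: le_ereal_inf_tmp => _ [t [t0 ht] <-].
rewrite -EFinM lee_fin ler_pdivrMr// mulr_natr leNgt; apply/negP => tN.
have [v [s [ps qs]]] := halfspace_separation hN tN ht
  (le_lt_trans (qdecay t t0) ht).
have close (r : probability (borelRd R d) R) : halfspace_TV r p <= eps%:E ->
    `|r [set x : borelRd R d | (s <= dot v x)%R]
      - p [set x : borelRd R d | (s <= dot v x)%R]| <= eps%:E.
  by apply: le_trans; apply: ereal_sup_ubound; exists (v, s).
have pstar_near : halfspace_TV pstar p <= eps%:E.
  exact: le_trans (halfspace_TV_le_TV _ _) hTV.
have pstarG : class_G N (decay N pstar mustar) pstar by exists mustar.
have := close q (le_trans (qmin _ pstarG) pstar_near).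
have := close pstar pstar_near.
move: ps qs; set H := [set x | _].
have mH : measurable H by exact: measurable_halfspace.
have fineE (r : probability (borelRd R d) R) : r H = (fine (r H))%:E.
  by rewrite fineK// fin_num_measure.
rewrite (fineE pstar) (fineE q) (fineE p) -!EFinB !lte_fin !lee_fin !ler_norml.
lra.
Qed.
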